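(* Let $f,g:[0,1]\to[0,1]$ be given by $f(x)=3x$ for $x\in[0,\frac13]$, $f(x)=-3x+2$ for $x\in(\frac13,\frac23)$, $f(x)=3x-2$ for $x\in[\frac23,1]$, and $g(x)=\frac13x$. Consider the random dynamical system applying $f$ with probability $p$ and $g$ with probability $1-p$ at each step. If $\frac12<p\le 1$, then for $y=0$ there exists a sequence $\{x^{(k)}\}_{k=1}^\infty$ of points in $[0,1]$ such that $$\lim_{k\to\infty}\int_0^1\bigl(F_{x^{(k)}y}^\star(t)-F_{x^{(k)}y}(t)\bigr)\,\mathrm{d}t=\frac{6p-3}{4p-1}.$$
   Context: At each step, independently, $f$ is applied with probability $p$ and $g$ with probability $1-p$. Formally, $\Omega=\{f,g\}^{\infty}$ carries the product probability measure $P$ under which the coordinates $\omega_1,\omega_2,\ldots$ are independent with $P(\omega_i=f)=p$, $P(\omega_i=g)=1-p$. For $x\in[0,1]$ the trajectory is $x_0=x$, $x_n(\omega)=\omega_n\circ\omega_{n-1}\circ\cdots\circ\omega_1(x)$. For two starting points $x,y$ the trajectories $x_n$ and $y_n$ are driven by the same $\omega$. Define, for $n\ge 1$ and $t\in\mathbb{R}$, $$F_{xy}^{(n)}(t)=\frac1n\sum_{i=0}^{n-1}P(|x_i-y_i|<t),\quad F_{xy}(t)=\liminf_{n\to\infty}F_{xy}^{(n)}(t),\quad F_{xy}^\star(t)=\limsup_{n\to\infty}F_{xy}^{(n)}(t).$$ *)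

(* Defs.v *)
From mathcomp Require Import all_boot all_order all_algebra.
From mathcomp Require Import finmap.
From mathcomp Require Import all_classical all_reals all_analysis.
Import Order.TTheory GRing.Theory Num.Theory.
Import numFieldNormedType.Exports.

Set Implicit Arguments.
Unset Strict Implicit.
Unset Printing Implicit Defensive.

Local Open Scope classical_set_scope.
Local Open Scope ring_scope.

(* Points of [0, 1] are reals carrying a membership hypothesis; zigzag and third
   both send [0, 1] into itself, and their values elsewhere are irrelevant. *)
Definition zigzag (R : realType) (x : R) : R :=
  if x <= 3^-1 then 3 * x
  else if x < 2 / 3 then - (3 * x) + 2
  else 3 * x - 2.

Definition third (R : realType) (x : R) : R := 3^-1 * x.

(* The letters {f, g} are encoded by bool: true stands for f, false for g. *)
Definition step (R : realType) (b : bool) : R -> R :=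
  if b then @zigzag R else @third R.

Definition coordinate_events : set_system (nat -> bool) :=
  [set A | exists i b, A = [set w | w i = b]].

(* {f, g}^oo with its product sigma-algebra; the coordinate w n is the letter
   written omega_{n+1}. *)
Definition Omega := g_sigma_algebraType coordinate_events.

(* The product probability on Omega with P(f) = p and P(g) = 1 - p at every
   coordinate: each coordinate has this law, and the coordinates are mutually
   independent. These conditions determine P. *)
Definition is_product_probability (R : realType) (p : R)
    (P : probability Omega R) : Prop :=
  [/\ forall i : nat, P [set w : Omega | w i = true] = p%:E,
      forall i : nat, P [set w : Omega | w i = false] = (1 - p)%:E &
      forall (J : {fset nat}) (B : nat -> set bool),
        P (\bigcap_(i in [set` J]) [set w : Omega | B i (w i)]) =
        (\prod_(i <- J) P [set w : Omega | B i (w i)])%E].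

Fixpoint trajectory (R : realType) (x : R) (w : Omega) (n : nat) : R :=
  if n is m.+1 then step (w m) (trajectory x w m) else x.

(* F_{xy}^{(n)}(t); only n >= 1 is meaningful, and n = 0 plays no role in the
   limits below. *)
Definition F_avg (R : realType) (P : probability Omega R) (x y : R)
    (n : nat) (t : R) : \bar R :=
  ((n%:R^-1)%:E *
   \sum_(0 <= i < n)
     P [set w : Omega | (`|trajectory x w i - trajectory y w i| < t)%R])%E.

Definition F_lower (R : realType) (P : probability Omega R) (x y t : R) :
    \bar R := limn_einf (fun n => F_avg P x y n t).

Definition F_upper (R : realType) (P : probability Omega R) (x y t : R) :
    \bar R := limn_esup (fun n => F_avg P x y n t).

(* Main.v *)
(* Since [f \o g] is the identity, x_n = 3^-b_n * f^a_n x, where b_n counts the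
   pending applications of g and a_n the applications of f made when none is
   pending. As p > 1/2, b_n is a positive recurrent reflected walk with geometric
   stationary law P(b >= j) = r^j, r = (1 - p) / p, and a_n tends to infinity in
   probability, with a_n <= n. Let x be the Cantor point whose ternary digits are
   constant, alternately 0 and 2, on blocks of extremely fast growing length. At the
   end of a 0-block f^a_n x has been close to 0 most of the time, so F^* = 1 on
   (0, 1]; at the end of a 2-block it has been close to 1 and x_n close to 3^-b_n,
   which is the supremum of its possible values, so F(t) = P(3^-b <= t). Hence the
   integral of F^* - F is E(3^-b) = (1 - r) / (1 - r / 3), and the constant sequence
   equal to x works. *)
Require Import Defs.
From mathcomp Require Import all_boot all_order all_algebra.
From mathcomp Require Import finmap lra ring zify.
From mathcomp Require Import all_classical all_reals all_analysis measurable_realfun.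
Import Order.TTheory GRing.Theory Num.Theory.
Import numFieldNormedType.Exports.
Local Open Scope classical_set_scope.
Local Open Scope ring_scope.

(** * Expectations along a random walk driven by letters *)

Section RandomWalk.
Set Implicit Arguments.
Unset Strict Implicit.
Context {R : realType} {S : Type}.
Variables (p : R) (move : bool -> S -> S).
Implicit Types (phi psi : S -> R) (s : S).

Fixpoint walk (w : nat -> bool) (n : nat) (s : S) : S :=
  if n is m.+1 then move (w m) (walk w m s) else s.

(** The Markov operator of the walk. Its iterates are expectations in purely algebraic form, so that
    measure theory enters only through [probability_walk]. *)
Definition mean_step phi s : R :=
  p * phi (move true s) + (1 - p) * phi (move false s).

Definition mean (n : nat) : (S -> R) -> S -> R := iter n mean_step.

(** [mean] conditions on the first move; conditioning on the last one instead gives recursions in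
    time from a fixed initial state. *)
Lemma meanSr n phi s : mean n.+1 phi s = mean n (mean_step phi) s.
Proof. by rewrite /mean iterSr. Qed.

Lemma mean_lin n a b phi psi s :
  mean n (fun s => a * phi s + b * psi s) s = a * mean n phi s + b * mean n psi s.
Proof.
elim: n s => [//|n IH] s; rewrite /mean/= /mean_step -!/(mean _ _ _) !IH; ring.
Qed.

Lemma mean_cst n a s : mean n (fun=> a) s = a.
Proof.
elim: n s => [//|n IH] s; rewrite /mean/= /mean_step -!/(mean _ _ _) !IH; ring.
Qed.

Lemma eq_mean n phi psi s : phi =1 psi -> mean n phi s = mean n psi s.
Proof. by move=> /funext ->. Qed.

Hypothesis p01 : 0 <= p <= 1.

(* At time [m] the chain is in [I m], so only the comparison on [I (m + n)]
   matters. *)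
Lemma le_mean_in (I : nat -> S -> Prop) m n phi psi s :
  (forall m b s, I m s -> I m.+1 (move b s)) ->
  (forall s, I (m + n)%N s -> phi s <= psi s) -> I m s ->
  mean n phi s <= mean n psi s.
Proof.
move=> II; elim: n m s => [|n IH] m s le Is; first by apply: le; rewrite addn0.
rewrite /mean/= /mean_step -!/(mean _ _ _).
have /andP[p0 p1] := p01.
by rewrite lerD// ler_wpM2l// ?subr_ge0//; apply: (IH m.+1);
  rewrite ?addSnnS//; exact: II.
Qed.

Lemma le_mean n phi psi s :
  (forall s, phi s <= psi s) -> mean n phi s <= mean n psi s.
Proof. by move=> le; apply: (@le_mean_in (fun _ _ => True) 0). Qed.

End RandomWalk.

(** * From expectations to probabilities of events in [Omega] *)

Section Cylinders.
Set Implicit Arguments.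
Unset Strict Implicit.
Context {R : realType}.
Variables (p : R) (P : probability Omega R).
Hypothesis hP : is_product_probability p P.

Definition cylinder (m : nat) (u : nat -> bool) : set Omega :=
  [set w | forall i, (i < m)%N -> w i = u i].

Definition set_letter (u : nat -> bool) (m : nat) (c : bool) : nat -> bool :=
  fun i => if i == m then c else u i.

Lemma cylinder_set_letter m u c :
  cylinder m.+1 (set_letter u m c) = cylinder m u `&` [set w | w m = c].
Proof.
apply/seteqP; split => [w cw|w [cw wm] i].
  split; last by rewrite /= cw// /set_letter eqxx.
  move=> i im; rewrite (cw i (ltnW im)) /set_letter.
  by rewrite ltn_eqF.
rewrite ltnS /set_letter; case: eqVneq => [-> _//|/negPf im].
by rewrite leq_eqVlt im/= => /cw.
Qed.

Lemma cylinder_split m u :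
  cylinder m u = cylinder m.+1 (set_letter u m true) `|`
                 cylinder m.+1 (set_letter u m false).
Proof.
rewrite !cylinder_set_letter -setIUr; apply/esym/setIidl => w _ /=.
by case: (w m); [left|right].
Qed.

Lemma measurable_letter i b : measurable [set w : Omega | w i = b].
Proof. by apply: sub_sigma_algebra; exists i, b. Qed.

Lemma measurable_cylinder m u : measurable (cylinder m u).
Proof.
elim: m u => [|m IH] u.
  by rewrite (_ : cylinder 0 u = setT)//; apply/seteqP; split.
rewrite (_ : cylinder m.+1 u = cylinder m.+1 (set_letter u m (u m))).
  rewrite cylinder_set_letter; apply: measurableI => //; exact: measurable_letter.
congr (cylinder _ _); apply/funext => i.
by rewrite /set_letter; case: eqVneq => [->|].
Qed.

Lemma probability_cylinder m u :
  P (cylinder m u) = (\prod_(i < m) (if u i then p else 1 - p))%:E.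
Proof.
have [Pt Pf Pind] := hP.
have -> : cylinder m u =
    \bigcap_(i in [set` [fset i in iota 0 m]%fset])
      [set w : Omega | [set u i] (w i)].
  apply/seteqP; split => w /= cw i.
    by rewrite /= inE/= mem_iota add0n => /cw.
  by move=> im; apply: cw => /=; rewrite inE/= mem_iota.
rewrite (Pind _ (fun i => [set u i])).
rewrite (perm_big (iota 0 m)) /=; last first.
  apply: uniq_perm; [exact: fset_uniq|exact: iota_uniq|].
  by move=> i; rewrite !inE.
rewrite -[m in iota 0 m]subn0 -/(index_iota 0 m) big_mkord.
elim/big_rec2: _ => // i y1 y2 _ ->; rewrite EFinM; congr (_ * _)%E.
by case: (u i).
Qed.

Lemma probability_cylinderS m u c :
  P (cylinder m.+1 (set_letter u m c)) =
  (P (cylinder m u) * (if c then p else 1 - p)%:E)%E.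
Proof.
rewrite !probability_cylinder -EFinM big_ord_recr/= {2}/set_letter eqxx.
congr (_ * _)%:E; apply: eq_bigr => i _.
by rewrite /set_letter ltn_eqF.
Qed.

Lemma walk_eq (S : Type) (move : bool -> S -> S) m s u w :
  cylinder m u w -> walk move w m s = walk move u m s.
Proof.
elim: m => [//|m IH] cw /=; rewrite (cw m)// IH// => i im.
by rewrite cw// ltnW.
Qed.

(** Fixing the first [m] letters makes the induction on [n] work: the cylinder splits along its next
    letter, and the two halves carry the weights [p] and [1 - p] of [mean_step]. Measurability is
    proved along the way because additivity of [P] requires it. *)
Lemma probability_walk_cylinder (S : Type) (move : bool -> S -> S)
    (B : S -> bool) s n m u :
  let E := cylinder m u `&` [set w : Omega | B (walk move w (n + m) s)] in
  measurable E /\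
  P E = (P (cylinder m u) *
         (mean p move n (fun s => (B s)%:R) (walk move u m s))%:E)%E.
Proof.
elim: n m u => [|n IH] m u /=.
  rewrite add0n /mean/=.
  have [b|b] := boolP (B (walk move u m s)).
    rewrite (_ : _ `&` _ = cylinder m u) ?mule1.
      by split => //; exact: measurable_cylinder.
    by apply/setIidl => w /= cw; rewrite (walk_eq _ _ cw).
  rewrite (_ : _ `&` _ = set0) ?mule0 ?measure0//.
  by apply/seteqP; split => // w [cw /=]; rewrite (walk_eq _ _ cw) (negPf b).
have [Mt Et] := IH m.+1 (set_letter u m true).
have [Mf Ef] := IH m.+1 (set_letter u m false).
move: Mt Et Mf Ef; rewrite /= addnS -addSn => Mt Et Mf Ef.
have EU : cylinder m u `&` [set w : Omega | B (walk move w (n.+1 + m) s)] =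
  (cylinder m.+1 (set_letter u m true) `&` [set w : Omega | B (walk move w (n.+1 + m) s)])
  `|` (cylinder m.+1 (set_letter u m false) `&` [set w : Omega | B (walk move w (n.+1 + m) s)]).
  by rewrite -setIUl -cylinder_split.
split; first by rewrite EU; exact: measurableU.
rewrite EU measureU//=; last first.
  rewrite setIACA [X in X `&` _](_ : _ = set0) ?set0I//.
  rewrite !cylinder_set_letter; apply/seteqP; split => // w [[_ /= ->]].
  by case.
rewrite [X in (X + _)%E]Et [X in (_ + X)%E]Ef !probability_cylinderS.
have swu c : walk move (set_letter u m c) m s = walk move u m s.
  by apply: walk_eq => i im; rewrite /set_letter ltn_eqF.
rewrite /= !swu /set_letter !eqxx probability_cylinder -!EFinM -EFinD.
congr EFin; rewrite /mean/= /mean_step; ring.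
Qed.

Lemma probability_walk (S : Type) (move : bool -> S -> S) (B : S -> bool) s n :
  P [set w : Omega | B (walk move w n s)] =
  (mean p move n (fun s => (B s)%:R) s)%:E.
Proof.
have [_] := probability_walk_cylinder move B s n 0 (fun=> true).
rewrite addn0 (_ : cylinder 0 _ = setT) ?setTI ?probability_setT ?mul1e//.
by apply/seteqP; split.
Qed.

End Cylinders.

(** * The reflected walk of pending letters, and the growth of the fold count *)

Section Queue.
Set Implicit Arguments.
Unset Strict Implicit.

(* The state [(a, b)] encodes the composition [g^b \o f^a]: since [f \o g] is the
   identity, applying [f] cancels a pending [g] if there is one. *)
Definition queue_step (c : bool) (s : nat * nat) : nat * nat :=
  if c then (if s.2 is b.+1 then (s.1, b) else (s.1.+1, 0%N)) else (s.1, s.2.+1).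

Context {R : realType}.
Variable p : R.
Hypothesis hp : 1 / 2 < p <= 1.

Let r : R := (1 - p) / p.
Let E (n : nat) (phi : nat * nat -> R) : R := mean p queue_step n phi (0%N, 0%N).

Let p0 : 0 < p. Proof. by move: hp => /andP[]; lra. Qed.
Let p01 : 0 <= p <= 1. Proof. by move: hp p0 => /andP[]; lra. Qed.
Let pr : p * r = 1 - p. Proof. by rewrite /r mulrC divfK// gt_eqF. Qed.
Let r0 : 0 <= r. Proof. by rewrite divr_ge0 ?(ltW p0)//; move: hp; lra. Qed.
Let r1 : r < 1. Proof. by rewrite ltr_pdivrMr// mul1r; move: hp; lra. Qed.

Definition tail (n j : nat) : R := E n (fun s => (j <= s.2)%:R).

Lemma tailn0 n : tail n 0 = 1.
Proof. exact: mean_cst. Qed.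

(** Conditioning on the last letter. Reflection at an empty queue needs no correction term, since
    the level [j.+1] is positive. *)
Lemma tailSS n j : tail n.+1 j.+1 = p * tail n j.+2 + (1 - p) * tail n j.
Proof.
rewrite /tail /E meanSr -mean_lin; apply: eq_mean => -[a [|b]];
  by rewrite /mean_step/= ?ltnS// !ltn0.
Qed.

(** The stationary tail [r ^+ j] solves the recursion [tailSS] because [p * r = 1 - p], and it
    dominates the tail of the empty initial queue; the recursion preserves this order. *)
Lemma tail_le n j : tail n j <= r ^+ j.
Proof.
elim: n j => [|n IH] [|j]; rewrite ?tailn0 ?expr0//.
  by rewrite /tail /E /mean/= exprn_ge0.
have -> : r ^+ j.+1 = p * r ^+ j.+2 + (1 - p) * r ^+ j.
  transitivity ((p * r + p) * r ^+ j.+1); first by rewrite pr subrK mul1r.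
  by rewrite -pr !exprS; ring.
by rewrite tailSS lerD// ler_wpM2l// ?(ltW p0)//; move: hp; lra.
Qed.

(** Any [q] strictly between [r] and 1 would do, since [1 - lam = p * (1 - q) * (q - r) / q]; the
    midpoint is taken. *)
Let q : R := (1 + r) / 2.
Let lam : R := p * q + (1 - p) / q.
Let q0 : 0 < q. Proof. rewrite /q; move: r0; lra. Qed.
Let q1 : q < 1. Proof. rewrite /q; move: r1; lra. Qed.
Let lam0 : 0 <= lam.
Proof.
have p1 : 0 <= 1 - p by rewrite subr_ge0; case/andP: hp.
apply: addr_ge0; apply: mulr_ge0 => //; rewrite ?invr_ge0 ltW //.
Qed.

Let lam1 : lam < 1.
Proof.
have -> : lam = 1 - p * (1 - q) * (q - r) / q.
  transitivity (p + p * r - p * (1 - q) * (q - r) / q).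
    by rewrite /lam -pr; field; exact: lt0r_neq0.
  by rewrite pr (addrC p) subrK.
rewrite ltrBlDr ltrDl divr_gt0// mulr_gt0//; last by rewrite /q; move: r1; lra.
by rewrite mulr_gt0// subr_gt0.
Qed.

(* [q ^ (a - b)] is an eigenfunction of [mean_step] with eigenvalue [lam < 1]. *)
Lemma mean_fold_lt L n :
  E n (fun s => (s.1 < L)%:R) <= q ^- L * lam ^+ n.
Proof.
pose phi (s : nat * nat) : R := q ^+ s.1 / q ^+ s.2.
have qn0 : q != 0 by rewrite gt_eqF.
have phiE m : E m phi = lam ^+ m.
  elim: m => [|m IH]; first by rewrite /E /mean/= /phi/= invr1 mulr1.
  rewrite /E meanSr exprS -IH -[RHS]addr0 -[X in _ + X](mul0r (E m phi)) -mean_lin.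
  apply: eq_mean => -[a [|b]]; rewrite /mean_step /phi /lam/= !exprS.
    by field.
  by field; rewrite qn0 expf_neq0.
rewrite -phiE -[leRHS]addr0 -[X in _ + X](mul0r (E n phi)) -mean_lin.
apply: le_mean => // -[a b] /=; rewrite mul0r addr0.
have phi0 : 0 <= q ^- L * phi (a, b).
  by rewrite !mulr_ge0 ?invr_ge0 ?exprn_ge0 ?(ltW q0).
case: ltnP => //= aL.
rewrite /phi/= mulrA ler_pdivlMr ?exprn_gt0// mul1r.
apply: le_trans (exprn_ile1 _ (ltW q0) (ltW q1)) _.
rewrite mulrC ler_pdivlMr ?exprn_gt0// mul1r.
by apply: ler_wiXn2l => //; rewrite ?(ltW q0) ?(ltW q1)// ltnW.
Qed.

(** Summing the geometric bound of [mean_fold_lt]: the expected total time spent with fewer than [L]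
    folds is finite. The block lengths are later chosen from this [h]. *)
Lemma sum_mean_fold_lt :
  exists2 h : nat -> R, (forall L, 0 <= h L) & forall L N,
    \sum_(0 <= n < N) E n (fun s => (s.1 < L)%:R) <= h L.
Proof.
exists (fun L => q ^- L / (1 - lam)) => [L|L N].
  by rewrite divr_ge0 ?invr_ge0 ?exprn_ge0 ?(ltW q0)// subr_ge0 ltW.
apply: (@le_trans _ _ (\sum_(0 <= n < N) q ^- L * lam ^+ n)).
  by apply: ler_sum => n _; exact: mean_fold_lt.
rewrite -mulr_sumr ler_wpM2l ?invr_ge0 ?exprn_ge0 ?(ltW q0)//.
rewrite -[leRHS]mul1r.
have -> : \sum_(0 <= n < N) lam ^+ n = (1 - lam ^+ N) / (1 - lam).
  apply: (canRL (mulfK _)); first by rewrite subr_eq0 gt_eqF.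
  elim: N => [|N IH]; first by rewrite big_nil mul0r expr0 subrr.
  rewrite big_nat_recr//= mulrDl IH exprSr; ring.
rewrite ler_wpM2r ?invr_ge0 ?subr_ge0 ?(ltW lam1)//.
by rewrite lerBlDr lerDl exprn_ge0.
Qed.

(* [q ^- b] is a Lyapunov function of the queue. *)
Lemma mean_queue_bounded : exists C : R, forall n, E n (fun s => s.2%:R) <= C.
Proof.
pose w (s : nat * nat) : R := q ^- s.2.
pose K := 1 + (1 - lam)^-1.
have lam1' : 0 < 1 - lam by rewrite subr_gt0.
have qn0 : q != 0 by rewrite gt_eqF.
have wK m : E m w <= K.
  elim: m => [|m IH].
    by rewrite /E /mean/= /w/= invr1 /K lerDl invr_ge0 ltW.
  (* Drift inequality: one step sends [w] below [lam * w + 1], the constant 1 covering the empty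
     queue, and [lam * K + 1 <= K]. *)
  apply: (@le_trans _ _ (lam * E m w + 1 * E m (fun=> 1))).
    rewrite /E meanSr -mean_lin; apply: le_mean => // -[a [|b]];
      rewrite /mean_step /w/= ?invr1 !mulr1.
      by rewrite /lam expr1; move: (mulr_ge0 (ltW p0) (ltW q0)) hp; lra.
    rewrite ler_wpDr// le_eqVlt; apply/orP; left; apply/eqP; rewrite /lam !exprS.
    by field; rewrite qn0 expf_neq0.
  rewrite /E mean_cst mulr1 -/(E _ _).
  apply: (@le_trans _ _ (lam * K + 1)); first by rewrite lerD2r ler_wpM2l.
  have -> : lam * K + 1 = K - (1 - lam) by rewrite /K; field; rewrite gt_eqF.
  by rewrite gerBl ltW.
(* Bernoulli's inequality [b * (1 / q - 1) <= q ^- b] turns the bound on the exponential moment into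
   one on the mean. *)
have q1' : 0 < 1 / q - 1 by rewrite subr_gt0 ltr_pdivlMr// mul1r.
exists (K / (1 / q - 1)) => n; rewrite ler_pdivlMr//; apply: le_trans (wK n).
rewrite -[leLHS]addr0 -[X in _ + X](mul0r (E n w)) [_ * (1 / q - 1)]mulrC -mean_lin.
apply: le_mean => // -[a b]; rewrite mul0r addr0 /w/=.
elim: b => [|b IH]; first by rewrite mulr0 invr1.
have -> : b.+1%:R = b%:R + 1 :> R by rewrite natr1.
rewrite exprS (invfM q) mulrDr mulr1.
apply: (@le_trans _ _ (q ^- b + (1 / q - 1))); first by rewrite lerD2r.
have -> : q^-1 * q ^- b = q ^- b + (1 / q - 1) * q ^- b by ring.
rewrite lerD2l ler_peMr ?(ltW q1')// invf_ge1 ?exprn_gt0//.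
by rewrite exprn_ile1 ?(ltW q0) ?(ltW q1).
Qed.

(** In one step the mean queue length changes by [(1 - p) - p * tail n 1]; these increments
    telescope from an empty queue. *)
Lemma sum_tail1 N :
  p * \sum_(0 <= n < N) tail n 1 = N%:R * (1 - p) - E N (fun s => s.2%:R).
Proof.
elim: N => [|N IH].
  by rewrite big_nil /E /mean/= mulr0 mul0r subr0.
rewrite big_nat_recr//= mulrDr IH -natr1.
have -> : E N.+1 (fun s => s.2%:R) =
    1 * E N (fun s => s.2%:R) +
    1 * ((1 - p) * E N (fun=> 1) + (- p) * tail N 1).
  rewrite /tail /E meanSr -!mean_lin; apply: eq_mean => -[a [|b]];
    rewrite /mean_step/= -?natr1; ring.
rewrite /E mean_cst; ring.
Qed.

(* The deficit [d N j] of the sum with respect to [N * r ^ j] has increments in [j]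
   which decay at least geometrically, and [d N 1] is bounded by [sum_tail1]. *)
Lemma sum_tail_ge j :
  exists C : R, forall N, N%:R * r ^+ j - C <= \sum_(0 <= n < N) tail n j.
Proof.
have [C0 hC0] := mean_queue_bounded.
pose d N j := N%:R * r ^+ j - \sum_(0 <= n < N) tail n j.
have d0 N : d N 0%N = 0.
  rewrite /d expr0 mulr1 (eq_bigr (fun=> 1)) => [|n _]; last exact: tailn0.
  by rewrite big_const_nat subn0 iter_addr_0 subrr.
have d1 N : d N 1%N <= C0 / p.
  rewrite ler_pdivlMr// /d mulrBl -mulrA expr1 [_ * p]mulrC pr [_ * p]mulrC sum_tail1.
  by rewrite opprB addrC subrK.
(* Summed over time, [tailSS] holds for the partial sums up to the boundary term [tail N k.+1 >= 0],
   while [N * r ^ j] satisfies the recursion exactly. *)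
have dS N k : p * (d N k.+2 - d N k.+1) <= (1 - p) * (d N k.+1 - d N k).
  have tS : \sum_(0 <= n < N) tail n k.+1 + tail N k.+1 =
      p * \sum_(0 <= n < N) tail n k.+2 + (1 - p) * \sum_(0 <= n < N) tail n k.
    rewrite -big_nat_recr//= big_nat_recl//= !mulr_sumr -big_split/=.
    rewrite /tail {1}/E {1}/mean/= add0r.
    by apply: eq_bigr => i _; rewrite -/(tail _ _) tailSS.
  have t0 : 0 <= tail N k.+1.
    by rewrite -(mean_cst p queue_step N 0 (0%N, 0%N)); exact: le_mean.
  rewrite -subr_ge0 (_ : _ - _ = tail N k.+1)//.
  transitivity (N%:R * r ^+ k * ((1 - p) * (r - 1) - p * r * (r - 1)) +
    (p * \sum_(0 <= n < N) tail n k.+2 + (1 - p) * \sum_(0 <= n < N) tail n k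
    - \sum_(0 <= n < N) tail n k.+1)).
    rewrite /d !exprS; ring.
  by rewrite pr -tS; ring.
have de N k : d N k.+1 - d N k <= r ^+ k * d N 1%N.
  elim: k => [|k IH]; first by rewrite d0 subr0 expr0 mul1r.
  rewrite -(ler_pM2l p0) (le_trans (dS _ _))//.
  rewrite (exprS r k) -(mulrA r) (mulrA p) pr.
  by rewrite ler_wpM2l//; move: hp; lra.
have d1ge0 N : 0 <= d N 1%N.
  rewrite subr_ge0 (le_trans (@ler_sum _ _ _ _ _ (fun=> r ^+ 1) _))//.
    by move=> n _; exact: tail_le.
  by rewrite big_const_nat subn0 iter_addr_0 mulr_natl.
have dj N k : d N k <= k%:R * d N 1%N.
  elim: k => [|k IH]; first by rewrite d0 mul0r.
  rewrite -natr1 mulrDl mul1r -(subrK (d N k) (d N k.+1)) addrC lerD//.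
  by rewrite (le_trans (de _ _))// ler_piMl// exprn_ile1// ltW.
exists (j%:R * (C0 / p)) => N; rewrite lerBlDr addrC -lerBlDr.
by rewrite (le_trans (dj N j))// ler_wpM2l.
Qed.

End Queue.

(** * Epsilon criteria for upper and lower limits *)

Section LimsupLiminf.
Context {R : realType}.
Implicit Types (u : R^nat) (c : R).

Lemma limn_esup_EFin u c :
  (forall e, 0 < e -> \forall n \near \oo, u n <= c + e) ->
  (forall e M, 0 < e -> exists2 n, (M <= n)%N & c <= u n + e) ->
  limn_esup (EFin \o u) = c%:E.
Proof.
move=> ub lb; apply/eqP; rewrite eq_le /limn_esup limf_esupE.
apply/andP; split; last first.
  apply: le_ereal_inf_tmp => _ [A [M _ MA] <-].
  apply/lee_addgt0Pr => e e0; have [n Mn cu] := lb e M e0.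
  apply: (@le_trans _ _ ((u n)%:E + e%:E)%E); first by rewrite -EFinD lee_fin.
  rewrite leeD2r//; apply: ereal_sup_ubound.
  by exists n => //; exact: MA.
apply/lee_addgt0Pr => e e0; have [M _ HM] := ub e e0.
apply: (@le_trans _ _ (ereal_sup ((EFin \o u) @` [set n | (M <= n)%N]))).
  by apply: ereal_inf_lbound; exists [set n | (M <= n)%N] => //; exists M.
by apply: ge_ereal_sup => _ [n Mn <-]; rewrite -EFinD lee_fin; exact: HM.
Qed.

Lemma limn_einf_EFin u c :
  (forall e, 0 < e -> \forall n \near \oo, c <= u n + e) ->
  (forall e M, 0 < e -> exists2 n, (M <= n)%N & u n <= c + e) ->
  limn_einf (EFin \o u) = c%:E.
Proof.
move=> lb ub; rewrite /limn_einf.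
rewrite (_ : (\- _)%E = EFin \o (fun n => - u n))//.
rewrite (@limn_esup_EFin _ (- c)) ?EFinN ?oppeK// => [e e0|e M e0].
  by have := lb e e0; apply: filterS => n; lra.
by have [n Mn un] := ub e M e0; exists n => //; lra.
Qed.

End LimsupLiminf.

(** * Cantor points and their trajectories *)

Section Ternary.
Context {R : realType}.
Variable d : nat -> bool.

Definition ternary_partial (a n : nat) : R :=
  \sum_(0 <= j < n) 2 * (d (a + j)%N)%:R / 3 ^+ j.+1.

(* [ternary a] is the point of the Cantor set with ternary digits
   [2 d_a, 2 d_{a+1}, ...]. *)
Definition ternary (a : nat) : R := limn (ternary_partial a).

Lemma ternary_partial_bound a n :
  0 <= ternary_partial a n <= 1 - 3^-1 ^+ n.
Proof.
rewrite /ternary_partial; elim: n => [|n /andP[IH1 IH2]].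
  by rewrite big_nil expr0 subrr lexx.
rewrite big_nat_recr//= !exprVn !exprS invfM.
have t0 : 0 <= (3 ^+ n)^-1 :> R by rewrite invr_ge0 exprn_ge0.
rewrite exprVn in IH2.
case: (d _) => /=; rewrite ?mulr0 ?mul0r ?mulr1 ?mulrA; apply/andP; split; lra.
Qed.

Lemma cvg_ternary a : ternary_partial a @ \oo --> ternary a.
Proof.
apply: nondecreasing_is_cvgn.
  apply/nondecreasing_seqP => n.
  rewrite /ternary_partial big_nat_recr//= lerDl.
  by rewrite divr_ge0 ?exprn_ge0// mulr_ge0.
exists 1 => _ [n _ <-]; have /andP[_ /le_trans] := ternary_partial_bound a n; apply.
by rewrite gerBl exprn_ge0.
Qed.

Lemma ternary_ge0 a : 0 <= ternary a.
Proof.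
apply: limr_ge; first by apply/cvg_ex; exists (ternary a); exact: cvg_ternary.
by apply: nearW => n; have /andP[] := ternary_partial_bound a n.
Qed.

Lemma ternary_le1 a : ternary a <= 1.
Proof.
apply: limr_le; first by apply/cvg_ex; exists (ternary a); exact: cvg_ternary.
apply: nearW => n; have /andP[_ /le_trans] := ternary_partial_bound a n; apply.
by rewrite gerBl exprn_ge0.
Qed.

Lemma ternaryS a : ternary a = (2 * (d a)%:R + ternary a.+1) / 3.
Proof.
suff: ternary_partial a @ \oo --> (2 * (d a)%:R + ternary a.+1) / 3.
  by move/cvg_lim; apply; exact: Rhausdorff.
rewrite -cvg_shiftS/=.
rewrite (_ : (fun n => _) =
  (fun n => (2 * (d a)%:R + ternary_partial a.+1 n) / 3)); last first.
  apply/funext => n; rewrite /ternary_partial big_nat_recl//= addn0 [RHS]mulrDl.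
  congr (_ + _); rewrite mulr_suml; apply: eq_bigr => i _.
  by rewrite addSnnS exprS invfM [3^-1 * _]mulrC mulrA.
apply: cvgM; last exact: cvg_cst.
by apply: cvgD; [exact: cvg_cst|exact: cvg_ternary].
Qed.

Lemma ternary_zeros a m :
  (forall i, (a <= i < a + m)%N -> d i = false) -> ternary a <= 3^-1 ^+ m.
Proof.
elim: m a => [|m IH] a da; first by rewrite expr0 ternary_le1.
rewrite ternaryS da ?leqnn ?addnS ?ltnS ?leq_addr// mulr0 add0r exprSr.
rewrite ler_wpM2r// IH// => i /andP[ai im]; apply: da.
by rewrite (ltnW ai) -addSnnS.
Qed.

Lemma ternary_ones a m :
  (forall i, (a <= i < a + m)%N -> d i = true) -> 1 - 3^-1 ^+ m <= ternary a.
Proof.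
elim: m a => [|m IH] a da; first by rewrite expr0 subrr ternary_ge0.
rewrite ternaryS da ?leqnn ?addnS ?ltnS ?leq_addr// exprSr.
have {}/IH : forall i, (a.+1 <= i < a.+1 + m)%N -> d i = true.
  by move=> i /andP[ai im]; apply: da; rewrite (ltnW ai) -addSnnS.
by rewrite /=; lra.
Qed.

Lemma ternary_lt1 a k : d (a + k)%N = false -> ternary a < 1.
Proof.
elim: k a => [|k IH] a dk; rewrite ternaryS.
  rewrite addn0 in dk; rewrite dk /=; have := ternary_le1 a.+1; lra.
rewrite -addSnnS in dk; have := IH _ dk.
by case: (d a) => /=; lra.
Qed.

(** A Cantor point never meets the decreasing middle branch, so [zigzag] acts on it as the shift of
    ternary digits. *)
Lemma zigzag_ternary a : zigzag (ternary a) = ternary a.+1.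
Proof.
have := ternary_ge0 a.+1; have := ternary_le1 a.+1.
rewrite /zigzag [ternary a]ternaryS; case: (d a) => /= h1 h0.
  by rewrite !ifF; [lra|apply/negbTE; rewrite -leNgt; lra|apply/negbTE; rewrite -ltNge; lra].
by rewrite ifT; lra.
Qed.

Lemma zigzag_third (x : R) : 0 <= x <= 1 -> zigzag (third x) = x.
Proof. by move=> /andP[x0 x1]; rewrite /zigzag /third ifT; lra. Qed.

Lemma third_iter_ternary01 a b : 0 <= 3^-1 ^+ b * ternary a <= 1.
Proof.
rewrite mulr_ge0 ?exprn_ge0 ?ternary_ge0//= mulr_ile1 ?exprn_ge0 ?ternary_ge0//.
  by rewrite exprn_ile1//; lra.
exact: ternary_le1.
Qed.

Lemma trajectory_ternary (w : Omega) n :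
  trajectory (ternary 0) w n =
  let s := walk queue_step w n (0%N, 0%N) in 3^-1 ^+ s.2 * ternary s.1.
Proof.
elim: n => [|n IH] /=; first by rewrite expr0 mul1r.
rewrite IH /=; case: (walk _ _ _ _) => a b /=.
case: (w n) => /=; last by rewrite /third exprS mulrA.
case: b => [|b]; first by rewrite expr0 !mul1r zigzag_ternary.
rewrite exprS -mulrA -/(third _) zigzag_third//; exact: third_iter_ternary01.
Qed.

Lemma trajectory0 (w : Omega) n : trajectory 0 w n = 0 :> R.
Proof.
elim: n => //= n ->; case: (w n) => /=; rewrite /zigzag /third ?mulr0//.
by rewrite invr_ge0 ler0n.
Qed.

End Ternary.

(** * The limiting step function and its integral *)

Section Staircase.
Set Implicit Arguments.
Unset Strict Implicit.
Context {R : realType}.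
Variable r : R.
Hypotheses (r0 : 0 <= r) (r1 : r < 1).

Let weight (j : nat) (t : R) : \bar R :=
  (((1 - r) * r ^+ j) * \1_(`]0, 3^-1 ^+ j[ : set R) t)%:E.

(** For [t > 0] this is the probability that [3^-b > t] when [b] has the stationary law, of mass
    [(1 - r) * r ^+ j] at [j]. The series of indicators can be integrated term by term; the
    intervals exclude 0 because both distribution functions vanish there. *)
Definition staircase (t : R) : \bar R := (\sum_(j <oo) weight j t)%E.

Let weight_ge0 j t : (0 <= weight j t)%E.
Proof. by rewrite lee_fin !mulr_ge0 ?exprn_ge0// subr_ge0 ltW. Qed.

Lemma staircase0 : staircase 0 = 0%E.
Proof.
rewrite /staircase eseries0// => j _ _; rewrite /weight indicE memNset ?mulr0//=.
by rewrite in_itv/= ltxx.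
Qed.

Lemma staircaseE t J : 0 < t -> 3^-1 ^+ J <= t ->
  (forall j, (j < J)%N -> t < 3^-1 ^+ j) -> staircase t = (1 - r ^+ J)%:E.
Proof.
move=> t0 tJ Jt; rewrite /staircase (nneseries_split 0 J) ?add0n//.
rewrite [X in (_ + X)%E]eseries0 ?adde0; last first.
  move=> j Jj _; rewrite /weight indicE memNset ?mulr0//= in_itv/= t0/=.
  apply/negP; rewrite -leNgt (le_trans _ tJ)//.
  by rewrite ler_wiXn2l// invf_le1// ler1n.
have -> : (1 - r ^+ J)%:E = (\sum_(0 <= j < J) ((1 - r) * r ^+ j)%:E)%E.
  rewrite sumEFin; congr EFin; elim: (J) => [|n IH].
    by rewrite expr0 subrr big_nil.
  by rewrite big_nat_recr//= -IH exprS; ring.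
rewrite !big_mkord; apply: eq_bigr => j _.
by rewrite /weight indicE mem_set ?mulr1//= in_itv/= t0/= Jt.
Qed.

(** The [j]-th interval has length [3^-j], so exchanging sum and integral leaves a geometric series
    of ratio [r / 3]. *)
Lemma integral_staircase :
  (\int[@lebesgue_measure R]_(t in `[0%R, 1%R]) staircase t =
   ((1 - r) / (1 - r / 3))%:E)%E.
Proof.
rewrite integral_nneseries//; last first.
  by move=> j; apply/measurable_EFinP; apply: measurable_funM.
have weightE j : (\int[@lebesgue_measure R]_(t in `[0%R, 1%R]) weight j t =
    (geometric (1 - r) (r / 3) j)%:E)%E.
  rewrite /weight; under eq_integral do rewrite EFinM.
  rewrite ge0_integralZl_EFin//; last 2 first.
  - by apply/measurable_EFinP; exact: measurable_indic.
  - by rewrite mulr_ge0 ?exprn_ge0// subr_ge0 ltW.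
  rewrite integral_indic// (_ : _ `&` _ = `]0, 3^-1 ^+ j[%classic).
    have /= -> := @lebesgue_measure_itv R `]0, 3^-1 ^+ j[.
    rewrite lte_fin exprn_gt0// oppr0 adde0.
    by rewrite -EFinM /geometric/= exprMn mulrA.
  apply/setIidl => t /=; rewrite !in_itv/= => /andP[t0 t1].
  have i3 : 3^-1 <= 1 :> R by lra.
  by rewrite (ltW t0) (le_trans (ltW t1))// exprn_ile1.
rewrite (eq_eseriesr (fun j _ => weightE j)); apply/cvg_lim => //.
rewrite (_ : (fun n => _) = EFin \o series (geometric (1 - r) (r / 3))); last first.
  by apply/funext => n /=; rewrite /series/= sumEFin.
apply: cvg_EFin; first by apply: nearW.
apply: cvg_geometric_series.
by rewrite ger0_norm ?divr_ge0// ltr_pdivrMr// mul1r (lt_trans r1)// ltr1n.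
Qed.

End Staircase.

(** * Digit blocks of rapidly growing length *)

Section Blocks.
Set Implicit Arguments.
Unset Strict Implicit.

(** The first condition leaves room for [k] reserve digits at the end of block [k]. The second makes
    the time [L k.+1 - k] so long that an expected delay of [h (L k)] before entering the block is
    at most a fraction [1 / k] of it. *)
Lemma growing_blocks (R : realType) (h : nat -> R) : (forall l, 0 <= h l) ->
  exists L : nat -> nat, forall k,
    (L k + k < L k.+1)%N /\ k%:R * h (L k) <= (L k.+1 - k)%:R.
Proof.
move=> h0.
pose next k l := (l + k + (Num.bound (k%:R * h l)).+1)%N.
pose L := fix L k := if k is i.+1 then next i (L i) else 0%N.
exists L => k; rewrite /= /next; split; first by rewrite -addn1 leq_add2l.
have kh0 : 0 <= k%:R * h (L k) by rewrite mulr_ge0.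
rewrite (le_trans (ltW (archi_boundP kh0)))// ler_nat; lia.
Qed.

Variable L : nat -> nat.
Hypothesis L_incr : forall k, (L k < L k.+1)%N.

Definition block_digit (a : nat) : bool :=
  `[< exists2 k, odd k & (L k <= a < L k.+1)%N >].

Lemma blocks_homo : {homo L : i j / (i <= j)%N}.
Proof. exact: (homo_leq leqnn leq_trans (fun k => ltnW (L_incr k))). Qed.

Lemma block_digitE a k : (L k <= a < L k.+1)%N -> block_digit a = odd k.
Proof.
move=> /andP[ka ak]; apply/asboolP/idP => [[k' ok' /andP[k'a ak']]|ok]; last first.
  by exists k => //; rewrite ka.
suff <- : k' = k by [].
apply/eqP; rewrite eqn_leq; apply/andP; split; rewrite leqNgt; apply/negP => /blocks_homo.
  by rewrite leqNgt (leq_ltn_trans k'a).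
by rewrite leqNgt (leq_ltn_trans ka).
Qed.

Lemma leq_block k : (k <= L k)%N.
Proof. by elim: k => // k IH; rewrite (leq_ltn_trans IH). Qed.

End Blocks.

Lemma archimedean_index (R : realType) (e : R) M : 0 < e ->
  exists k, [/\ (M <= k)%N, (0 < k)%N, 3^-1 ^+ k < e & k%:R^-1 < e].
Proof.
move=> e0.
have h3 : \forall k \near \oo, (3^-1 : R) ^+ k < e.
  have := @cvg_expr R 3^-1; rewrite ger0_norm ?invr_ge0// => /(_ _).
  move=> /(_ ltac:(lra)) /cvgrPdist_lt /(_ e e0); apply: filterS => k.
  by rewrite sub0r normrN ger0_norm// exprn_ge0.
have [k1 _ Hk1] := h3.
exists (maxn k1 (maxn M (Num.bound e^-1).+1)); split; [lia|lia| |].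
  by apply: Hk1 => /=; lia.
rewrite invf_plt ?posrE ?ltr0n//; last lia.
have e1 : 0 <= e^-1 by rewrite invr_ge0 ltW.
by rewrite (lt_le_trans (archi_boundP e1))// ler_nat; lia.
Qed.

(** * Time frequencies at the block ends and the limits [F_upper], [F_lower] *)

Section Frequencies.
Set Implicit Arguments.
Unset Strict Implicit.
Context {R : realType}.
Variables (p : R) (P : probability Omega R).
Hypotheses (hp : 1 / 2 < p <= 1) (hP : is_product_probability p P).
Variables (L : nat -> nat) (h : nat -> R).
Hypothesis sum_fold_lt : forall l N,
  \sum_(0 <= n < N) mean p queue_step n (fun s => (s.1 < l)%:R) (0%N, 0%N) <= h l.
Hypothesis L_blocks : forall k,
  (L k + k < L k.+1)%N /\ k%:R * h (L k) <= (L k.+1 - k)%:R.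

Let r : R := (1 - p) / p.
Let E (n : nat) (phi : nat * nat -> R) : R := mean p queue_step n phi (0%N, 0%N).
Let z : nat -> R := ternary (block_digit L).
Let point (s : nat * nat) : R := 3^-1 ^+ s.2 * z s.1.
Let horizon k := (L k.+1 - k)%N.

Definition frequency (t : R) (n : nat) : R :=
  n%:R^-1 * \sum_(0 <= i < n) E i (fun s => (point s < t)%R%:R).

Let p01 : 0 <= p <= 1. Proof. by move: hp => /andP[]; lra. Qed.

Let L_incr k : (L k < L k.+1)%N.
Proof. by have [+ _] := L_blocks k; apply: leq_ltn_trans; rewrite leq_addr. Qed.

Lemma F_avg_frequency t n : F_avg P (z 0) 0 n t = (frequency t n)%:E.
Proof.
rewrite /F_avg /frequency EFinM -sumEFin; congr (_ * _)%E; apply: eq_bigr => i _.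
rewrite /E -(probability_walk hP queue_step (fun s => (point s < t)%R)).
congr (P _); apply/funext => w /=.
rewrite trajectory0 subr0 trajectory_ternary ger0_norm//.
by have /andP[+ _] := @third_iter_ternary01 R (block_digit L)
  (walk queue_step w i (0, 0)%N).1 (walk queue_step w i (0, 0)%N).2; apply.
Qed.

Let block_near_end k a : (L k <= a < horizon k)%N ->
  forall i, (a <= i < a + k)%N -> block_digit L i = odd k.
Proof.
move=> /andP[ka ak] i /andP[ai ik]; apply: block_digitE => //.
by move: ak; rewrite /horizon => ak; apply/andP; split; lia.
Qed.

Let horizon_gt k : (k < horizon k)%N.
Proof.
by have [+ _] := L_blocks k; have := leq_block L_incr k; rewrite /horizon; lia.
Qed.

(** Each step makes at most one fold, so at time [i] only states with at most [i] folds matter. This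
    turns a bound on time into a bound on the digit position. *)
Let le_mean_time i (phi psi : nat * nat -> R) :
  (forall s, (s.1 <= i)%N -> phi s <= psi s) -> E i phi <= E i psi.
Proof.
move=> le; apply: (@le_mean_in _ _ _ _ p01 (fun m s => s.1 <= m)%N 0) => //.
by move=> m [] [a [|b]] //= /leqW.
Qed.

Let horizon_gt0 k : 0 < (horizon k)%:R :> R.
Proof. by rewrite ltr0n (leq_ltn_trans _ (horizon_gt k)). Qed.

Let sum_fold_le k : (0 < k)%N -> (horizon k)%:R^-1 *
  \sum_(0 <= i < horizon k) E i (fun s => (s.1 < L k)%:R) <= k%:R^-1.
Proof.
move=> k0; rewrite mulrC ler_pdivrMr// (le_trans (sum_fold_lt _ _))//.
by rewrite mulrC ler_pdivlMr ?ltr0n// mulrC; have [] := L_blocks k.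
Qed.

Lemma frequency_le1 t n : frequency t n <= 1.
Proof.
case: n => [|n]; first by rewrite /frequency invr0 mul0r.
rewrite /frequency mulrC ler_pdivrMr ?ltr0n// mul1r.
apply: (@le_trans _ _ (\sum_(0 <= i < n.+1) 1)); last first.
  by rewrite big_const_nat subn0 iter_addr_0.
apply: ler_sum => i _; rewrite -[leRHS](mean_cst p queue_step i 1 (0%N, 0%N)).
by apply: le_mean => // s; rewrite /= lern1 leq_b1.
Qed.

(* Up to time [horizon k] the folding count stays [k] digits away from the end of
   the block, and it is below [L k] only a [1 / k] fraction of the time. *)
Lemma frequency_even k t : (0 < k)%N -> ~~ odd k -> 3^-1 ^+ k < t ->
  1 - k%:R^-1 <= frequency t (horizon k).
Proof.
move=> k0 ok kt.
apply: (@le_trans _ _ ((horizon k)%:R^-1 *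
    \sum_(0 <= i < horizon k) (1 - E i (fun s => (s.1 < L k)%:R)))).
  rewrite big_split/= sumrN big_const_nat subn0 iter_addr_0 mulrBr mulVf ?gt_eqF//.
  by rewrite lerD2l lerN2 sum_fold_le.
rewrite /frequency ler_wpM2l ?invr_ge0//; apply: ler_sum_nat => i /andP[_ ik].
rewrite lerBlDr -[X in X + _]mul1r -[X in _ + X]mul1r.
rewrite -mean_lin -[leLHS](mean_cst p queue_step i 1 (0%N, 0%N)).
apply: le_mean_time. move=> -[a b] /= ai; rewrite !mul1r.
have [aL|La] := ltnP a (L k); first by rewrite lerDr.
suff pt : point (a, b) < t by rewrite pt addr0.
apply: le_lt_trans kt; apply: (@le_trans _ _ (z a)).
  by rewrite ler_piMl ?ternary_ge0// exprn_ile1//; lra.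
apply: ternary_zeros => l al; rewrite (block_near_end _ al) ?(negPf ok)//.
by rewrite La (leq_ltn_trans ai).
Qed.

(** Inside an odd block the next [k] digits are all 2, so [point (a, b) >= 3^-b * (1 - 3^-k)] and
    lying below [t] forces [b >= J]. That has probability at most [r ^+ J]; states before the block
    cost [1 / k]. *)
Lemma frequency_odd k J t : (0 < k)%N -> odd k ->
  (forall j, (j < J)%N -> t <= 3^-1 ^+ j * (1 - 3^-1 ^+ k)) ->
  frequency t (horizon k) <= r ^+ J + k%:R^-1.
Proof.
move=> k0 ok kt.
apply: (@le_trans _ _ ((horizon k)%:R^-1 *
    \sum_(0 <= i < horizon k) (r ^+ J + E i (fun s => (s.1 < L k)%:R)))); last first.
  rewrite big_split/= big_const_nat subn0 iter_addr_0 mulrDr -[r ^+ J *+ _]mulr_natl.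
  by rewrite mulKf ?gt_eqF// lerD2l sum_fold_le.
rewrite /frequency ler_wpM2l ?invr_ge0//; apply: ler_sum_nat => i /andP[_ ik].
apply: (@le_trans _ _ (tail p i J + E i (fun s => (s.1 < L k)%:R))); last first.
  by rewrite lerD2r tail_le.
rewrite /tail -[X in X + _]mul1r -[X in _ + X]mul1r -mean_lin.
apply: le_mean_time => -[a b] /= ai; rewrite !mul1r.
have [_|La] := ltnP a (L k); first by rewrite (@le_trans _ _ 1)// ?lern1 ?leq_b1// lerDr.
rewrite addr0; have [_|bJ] := leqP J b; first by rewrite lern1 leq_b1.
rewrite ltNge (le_trans (kt _ bJ))// /point/= ler_wpM2l ?exprn_ge0//.
apply: ternary_ones => l al; rewrite (block_near_end _ al)//.
by rewrite La (leq_ltn_trans ai).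
Qed.

(** Every tail of the digit sequence meets an even block and so contains a 0. Strictness matters in
    [frequency_ge], where [t = 3^-J] is allowed and only distances strictly below [t] count. *)
Let z_lt1 a : z a < 1.
Proof.
have aL : (a <= L a.*2)%N by have := leq_block L_incr a.*2; lia.
apply: (@ternary_lt1 _ _ _ (L a.*2 - a)%N); rewrite subnKC//.
by rewrite (@block_digitE _ L_incr _ a.*2) ?odd_double// leqnn L_incr.
Qed.

(** Whatever the digits, [b >= J] puts the point below [t]; the time spent there is bounded below by
    [sum_tail_ge], with a deficit independent of [n]. *)
Lemma frequency_ge J t : 3^-1 ^+ J <= t ->
  exists C : R, forall n, (0 < n)%N -> r ^+ J - C / n%:R <= frequency t n.
Proof.
move=> Jt; have [C HC] := sum_tail_ge hp J.
exists C => n n0; have nR : 0 < n%:R :> R by rewrite ltr0n.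
apply: (@le_trans _ _ (n%:R^-1 * (n%:R * r ^+ J - C))).
  by rewrite mulrBr mulKf ?gt_eqF// [_ * C]mulrC.
rewrite /frequency ler_wpM2l ?invr_ge0 ?(ltW nR)//; apply: le_trans (HC n) _.
apply: ler_sum => i _; apply: le_mean => // -[a b] /=.
case: leqP => //= Jb; suff pt : point (a, b) < t by rewrite pt.
have b0 : 0 < 3^-1 ^+ b :> R by rewrite exprn_gt0.
apply: lt_le_trans Jt; apply: (@lt_le_trans _ _ (3^-1 ^+ b)).
  by rewrite gtr_pMr.
by rewrite ler_wiXn2l//; lra.
Qed.

Lemma F_upper_eq1 t : 0 < t -> F_upper P (z 0) 0 t = 1%E.
Proof.
move=> t0; rewrite /F_upper (_ : (fun n => _) = EFin \o frequency t); last first.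
  by apply/funext => n; rewrite F_avg_frequency.
apply: limn_esup_EFin => [e e0|e M e0].
  by apply: nearW => n; rewrite (le_trans (frequency_le1 _ _))// lerDl ltW.
have et : 0 < Num.min e t by rewrite lt_min e0.
have [k [Mk k0]] := @archimedean_index R _ M et.
rewrite !lt_min => /andP[_ kt] /andP[ke _].
(* Doubling selects an even block and keeps both smallness conditions on [k]. *)
have k2 : (k <= k.*2)%N by lia.
exists (horizon k.*2); first by rewrite ltnW// (leq_ltn_trans _ (horizon_gt _))// (leq_trans Mk).
have := @frequency_even k.*2 t; rewrite odd_double double_gt0 => /(_ k0 isT).
have -> : 3^-1 ^+ k.*2 < t by rewrite (le_lt_trans _ kt)// ler_wiXn2l//; lra.
move=> /(_ isT); have : (k.*2)%:R^-1 <= k%:R^-1 :> R.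
  by rewrite lef_pV2 ?posrE ?ltr0n ?double_gt0// ler_nat.
move: ke; lra.
Qed.

Lemma F_lower_eq J t : 0 < t -> 3^-1 ^+ J <= t ->
  (forall j, (j < J)%N -> t < 3^-1 ^+ j) -> F_lower P (z 0) 0 t = (r ^+ J)%:E.
Proof.
move=> t0 Jt tJ; rewrite /F_lower (_ : (fun n => _) = EFin \o frequency t); last first.
  by apply/funext => n; rewrite F_avg_frequency.
apply: limn_einf_EFin => [e e0|e M e0].
  have [C HC] := frequency_ge Jt.
  exists (Num.bound (`|C| / e)).+1 => // n /= Cn.
  have n0 : (0 < n)%N by lia.
  have nR : 0 < n%:R :> R by rewrite ltr0n.
  rewrite -lerBlDr; apply: le_trans (HC _ n0); rewrite lerD2l lerN2.
  rewrite ler_pdivrMr// (le_trans (ler_norm _))// mulrC -ler_pdivrMr//.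
  have Ce : 0 <= `|C| / e by rewrite divr_ge0// ltW.
  rewrite (le_trans (ltW (archi_boundP Ce)))// ler_nat; lia.
(* The strict inequalities [t < 3^-j] for [j < J] leave a common relative margin [e'], dictated by
   the largest such [j]; for [J = 0] any value serves. It absorbs the factor [1 - 3^-k] of
   [frequency_odd]. *)
have [e' e'0 He'] : exists2 e', 0 < e' & forall j, (j < J)%N -> t <= 3^-1 ^+ j * (1 - e').
  case: J {Jt} tJ => [|J] tJ; first by exists 1.
  exists (1 - t / 3^-1 ^+ J).
    by rewrite subr_gt0 ltr_pdivrMr ?exprn_gt0// mul1r tJ.
  move=> j jJ; rewrite opprB addrC subrK mulrC -mulrA ler_peMr ?(ltW t0)//.
  rewrite mulrC ler_pdivlMr ?exprn_gt0// mul1r ler_wiXn2l//; lra.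
have em : 0 < Num.min e e' by rewrite lt_min e0.
have [k [Mk k0]] := @archimedean_index R _ M em.
rewrite !lt_min => /andP[_ kt] /andP[ke _].
have k2 : (k <= k.*2.+1)%N by lia.
exists (horizon k.*2.+1); first by rewrite ltnW// (leq_ltn_trans _ (horizon_gt _))// (leq_trans Mk).
apply: (le_trans (@frequency_odd k.*2.+1 J t _ _ _)) => //=.
- by rewrite odd_double.
- move=> j jJ; apply: (le_trans (He' _ jJ)); rewrite ler_wpM2l ?exprn_ge0//.
  by rewrite lerD2l lerN2 (le_trans _ (ltW kt))// ler_wiXn2l//; lra.
rewrite lerD2l (le_trans _ (ltW ke))//.
by rewrite lef_pV2 ?posrE ?ltr0n// ler_nat.
Qed.

Lemma F_upper_sub_lower t : 0 <= t ->
  (F_upper P (z 0) 0 t - F_lower P (z 0) 0 t)%E = staircase r t.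
Proof.
rewrite le_eqVlt => /predU1P[<-|t0].
  rewrite staircase0 /F_upper /F_lower.
  (* At [t = 0] no distance lies strictly below [t], so all averages vanish. *)
  have -> : (fun n => F_avg P (z 0) 0 n 0) = cst 0%E.
    apply/funext => n; rewrite F_avg_frequency /frequency big1 ?mulr0// => i _.
    rewrite -[RHS](mean_cst p queue_step i 0 (0%N, 0%N)); apply: eq_mean => -[a b].
    rewrite ltNge; have /andP[-> _//] := @third_iter_ternary01 R (block_digit L) a b.
  have cvg0 : (cst 0%E : (\bar R)^nat) @ \oo --> (0%E : \bar R) by exact: cvg_cst.
  have [-> ->] := cvg_limn_einf_sup cvg0.
  by rewrite sube0.
have exJ : exists J, 3^-1 ^+ J <= t.
  by have [k [_ _ /ltW kt _]] := @archimedean_index R _ 0 t0; exists k.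
case: (ex_minnP exJ) => J Jt Jmin.
have tJ j : (j < J)%N -> t < 3^-1 ^+ j.
  by move=> jJ; rewrite ltNge; apply/negP => /Jmin; rewrite leqNgt jJ.
rewrite F_upper_eq1// (F_lower_eq t0 Jt tJ) (staircaseE _ _ t0 Jt tJ)//.
- by rewrite divr_ge0; move: hp; lra.
- by rewrite ltr_pdivrMr; move: hp; lra.
Qed.

End Frequencies.

Theorem proposition5p3 (R : realType) (p : R) (hp : 1 / 2 < p <= 1)
    (P : probability Omega R) (hP : is_product_probability p P) :
  exists x : nat -> R,
    (forall k : nat, 0 <= x k <= 1) /\
    (fun k : nat => \int[@lebesgue_measure R]_(t in `[0%R, 1%R])
        (F_upper P (x k) 0 t - F_lower P (x k) 0 t)%E)%E @ \oo
      --> ((6 * p - 3) / (4 * p - 1))%:E.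
Proof.
(* The bound [h] concerns the queue alone and not the digits, so the blocks can be chosen after
   it. *)
have [h h0 hL] := sum_mean_fold_lt hp.
have [L L_blocks] := growing_blocks h0.
exists (fun=> ternary (block_digit L) 0); split => [_|].
  by rewrite ternary_ge0 ternary_le1.
have [p0 p1] : 0 < p /\ p <= 1 by move: hp; lra.
have r0 : 0 <= (1 - p) / p by rewrite divr_ge0 ?(ltW p0)// subr_ge0.
have r1 : (1 - p) / p < 1 by rewrite ltr_pdivrMr// mul1r; move: hp; lra.
rewrite (_ : (fun k => _) = cst ((6 * p - 3) / (4 * p - 1))%:E); first exact: cvg_cst.
apply/funext => _ /=.
transitivity (\int[@lebesgue_measure R]_(t in `[0%R, 1%R]) staircase ((1 - p) / p) t)%E.
  apply: eq_integral => t; rewrite inE/= in_itv/= => /andP[t0 _].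
  exact: (F_upper_sub_lower hp hP hL L_blocks).
(* With [r = (1 - p) / p], [1 - r = (2 * p - 1) / p] and [1 - r / 3 = (4 * p - 1) / (3 * p)]. *)
rewrite integral_staircase//; congr EFin.
by field; apply/andP; split; apply/eqP; move: hp; lra.
Qed.
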